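(* Let $k\in\{1,2,3\}$, let $G=(V,E)$ be a $k$-edge-connected graph, let $t\in V$, and let $\mathcal{T}=\{T_1,\dots,T_k\}$ be a set of $k$ arc-disjoint arborescences of $G$ rooted at $t$. Then any circular-arborescence routing on $\mathcal{T}$ (for any circular ordering of $\mathcal{T}$) is $(k-1)$-resilient for destination $t$ against dynamic failures.
   Context: Graphs are finite undirected multigraphs; ''$k$-connected'' means $k$-edge-connected. A link $\{u,v\}\in E$ gives two arcs $(u,v)$ and $(v,u)$. Dynamic failures: a set $F\subseteq E$ of unstable links; each link of $F$ may alternate arbitrarily between up and down over time (when down it fails in both directions), including while a packet travels; links outside $F$ are always up. Failover routing: for destination $t$, every node $v\ne t$ has a static deterministic forwarding function whose input is the in-port of the packet (or $\bot$ if the packet originates at $v$) and the set of links incident to $v$ that are currently up, and whose output is an outgoing link. A routing scheme for $t$ is $k$-resilient against dynamic failures if for every set $F$ of dynamic failures with $|F|\le k$, every packet originating at a node $s$ that is connected to $t$ in $G\setminus F$ (the graph with all of $F$ removed) is delivered to $t$, however the states of the links of $F$ evolve. Arborescences: an arborescence of $G$ rooted at $t$ is a directed spanning tree in which each $v\neq t$ has a unique directed path to $t$. Arborescences are arc-disjoint if no two share an arc (they may share an undirected edge in opposite directions). Canonical mode on $T$: the packet follows the directed path of $T$ to $t$. Circular-arborescence routing on $\mathcal{T}$ with circular ordering $\langle\mathcal{T}\rangle$: a packet originating at a node is sent in canonical mode along an arbitrarily chosen $T_i$ (usually the first one); whenever it hits a failed (currently down) arc of the current arborescence at a node $u$, it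 continues from $u$ in canonical mode along the next available arborescence, i.e. the first one following the current one in the circular ordering whose outgoing arc at $u$ is not failed; and so on until it arrives at $t$. *)

(* Defs.v *)
From HB Require Import structures.
From mathcomp Require Import all_boot.

Set Implicit Arguments.
Unset Strict Implicit.
Unset Printing Implicit Defensive.

(* Finite undirected multigraphs.  The order of the two ends of a link carries
   no meaning; it only serves to name the two arcs of the link. *)
Record multigraph := Multigraph {
  node : finType;
  link : finType;
  ends : link -> node * node }.

Section Multigraph.
Variable G : multigraph.

(* (e, true) and (e, false) are the two orientations of the link e, so that
   parallel links give distinct arcs. *)
Definition arc_of : finType := (link G * bool)%type.

Definition arc_link (a : arc_of) : link G := a.1.
Definition src (a : arc_of) : node G :=
  if a.2 then (ends (arc_link a)).1 else (ends (arc_link a)).2.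
Definition dst (a : arc_of) : node G :=
  if a.2 then (ends (arc_link a)).2 else (ends (arc_link a)).1.
Definition arc_rev (a : arc_of) : arc_of := (a.1, ~~ a.2).

Definition incident (v : node G) : {set link G} :=
  [set e | ((ends e).1 == v) || ((ends e).2 == v)].

Definition adjacent (D : {set link G}) : rel (node G) :=
  fun u v =>
    [exists a : arc_of, [&& arc_link a \in D, src a == u & dst a == v]].

Definition connected_by (D : {set link G}) : Prop :=
  forall u v : node G, connect (adjacent D) u v.

Definition edge_connected (k : nat) : Prop :=
  forall F : {set link G}, #|F| < k -> connected_by (~: F).

(* Loops and pairs of parallel links are cycles, of lengths 1 and 2. *)
Definition is_cycle (D : {set link G}) (c : seq arc_of) : bool :=
  [&& c != [::],
      all (fun a => arc_link a \in D) c,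
      cycle (fun a b => dst a == src b) c,
      uniq (map arc_link c)
    & uniq (map src c)].

Definition spanning_tree (D : {set link G}) : Prop :=
  connected_by D /\ forall c : seq arc_of, ~~ is_cycle D c.

Fixpoint walk (u : node G) (p : seq arc_of) (w : node G) : bool :=
  if p is a :: p' then (src a == u) && walk (dst a) p' w else u == w.

Definition directed_path (T : {set arc_of}) (u : node G) (p : seq arc_of)
    (w : node G) : bool :=
  [&& walk u p w, all (fun a => a \in T) p & uniq (u :: map dst p)].

(* The first two conditions say that T is an orientation of a spanning tree
   of G. *)
Definition arborescence (t : node G) (T : {set arc_of}) : Prop :=
  [/\ forall a : arc_of, a \in T -> arc_rev a \notin T,
      spanning_tree [set arc_link a | a in T]
    & forall v : node G, v != t -> exists! p, directed_path T v p t].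

(* f v p U is the choice made at v for a packet with in-port p, when U is the
   set of links at v that are up.  The in-port is given by the arc by which
   the packet arrived, or None if the packet originates at v.  The result
   None means that the packet is discarded; it is needed when U is empty. *)
Definition forwarding : Type :=
  node G -> option arc_of -> {set link G} -> option arc_of.

(* A packet is at a node with an in-port, or lost (None). *)
Definition packet_state : Type := option (node G * option arc_of).

Definition step (t : node G) (f : forwarding) (up : {set link G})
    (c : packet_state) : packet_state :=
  if c is Some (v, p) then
    if v == t then c
    else if f v p (up :&: incident v) is Some a then
      if (src a == v) && (arc_link a \in up) then Some (dst a, Some a)
      else None
    else None
  else None.

(* up n is the set of links that are up at the instant of the n-th hop. *)
Fixpoint run (t : node G) (f : forwarding) (up : nat -> {set link G})
    (s : node G) (n : nat) : packet_state :=
  if n is n'.+1 then step t f (up n') (run t f up s n') else Some (s, None).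

Definition delivered (t : node G) (f : forwarding) (up : nat -> {set link G})
    (s : node G) : Prop :=
  exists n p, run t f up s n = Some (t, p).

Definition dynamically_resilient (r : nat) (t : node G) (f : forwarding)
    : Prop :=
  forall F : {set link G}, #|F| <= r ->
  forall up : nat -> {set link G}, (forall n, ~: F \subset up n) ->
  forall s : node G, connect (adjacent (~: F)) s t ->
  delivered t f up s.

(* A circular ordering is a duplicate-free enumeration read cyclically: the
   successor of T is next ord T. *)
Definition circular_ordering (TT : {set {set arc_of}}) (ord : seq {set arc_of})
    : Prop :=
  uniq ord /\ ord =i TT.

(* a is the outgoing arc at v of the first arborescence, starting from T
   itself and going around ord, whose outgoing arc at v is not failed. *)
Definition first_available (ord : seq {set arc_of}) (v : node G)
    (U : {set link G}) (T : {set arc_of}) (a : arc_of) : Prop :=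
  exists j : nat,
    [/\ a \in iter j (next ord) T, src a = v, arc_link a \in U
      & forall i b, i < j -> b \in iter i (next ord) T -> src b = v ->
          arc_link b \notin U].

(* The current arborescence of a packet in transit is the one that contains
   the arc by which it arrived.  The arborescence chosen for a packet
   originating at v may depend on v and on the links at v that are up.  No
   condition is imposed when no arborescence has an available arc at v. *)
Definition circular_arborescence_routing (t : node G)
    (TT : {set {set arc_of}}) (ord : seq {set arc_of}) (f : forwarding) : Prop :=
  forall (v : node G) (U : {set link G}), v != t -> U \subset incident v ->
    (exists2 T, T \in TT &
       forall b, first_available ord v U T b -> f v None U = Some b) /\
    (forall T a b, T \in TT -> a \in T -> dst a = v ->
       first_available ord v U T b -> f v (Some a) U = Some b).

End Multigraph.

(* Main.v *)
Require Import Defs.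
From mathcomp Require Import all_boot.

(* Call a hit an arc x of an arborescence S at which the packet finds the link
   down; the packet then follows S', the successor of S, from the source of x.
   That path cannot contain x (arc-disjointness) nor its reverse (it would
   return to its first node), so the next hit is on another failing link.  For
   k <= 2 there are therefore at most k - 1 hits.  For k = 3 the hits alternate
   between two links, so among five consecutive ones the first, the third and
   the fifth are on the same link; but they lie in three different
   arborescences, whereas a link has only two arcs. *)

Set Implicit Arguments.
Unset Strict Implicit.
Unset Printing Implicit Defensive.

(** * Paths and cycles in an arborescence *)

Section Arborescences.
Variable G : multigraph.
Implicit Types (a b x y z : arc_of G) (u v w t : node G).
Implicit Types (p q : seq (arc_of G)) (T S : {set arc_of G}).

Lemma same_link a b : arc_link a = arc_link b -> b = a \/ b = arc_rev a.
Proof.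
case: a b => [e o] [e' o']; rewrite /arc_link /arc_rev /= => <-.
by case: o o' => [] []; [left | right | right | left].
Qed.

Lemma src_rev a : src (arc_rev a) = dst a.
Proof. by rewrite /src /dst /=; case: a.2. Qed.

Lemma link_at_src a : arc_link a \in incident (src a).
Proof. by rewrite inE /src; case: a.2; rewrite eqxx ?orbT. Qed.

Lemma walk_nodes u p w :
  walk u p w -> rcons (map (@src G) p) w = u :: map (@dst G) p.
Proof.
elim: p u => [|a p IHp] u /=; first by move/eqP=> ->.
by case/andP=> /eqP -> /IHp ->.
Qed.

Lemma walk_cat u p q w : walk u (p ++ q) w -> exists2 v, walk u p v & walk v q w.
Proof.
elim: p u => [|a p IHp] u /=; first by exists u.
by case/andP=> -> /IHp.
Qed.

Lemma walk_last u p b w : walk u (rcons p b) w -> dst b = w.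
Proof. by elim: p u => [|a p IHp] u /= /andP[_]; [move/eqP | exact: IHp]. Qed.

Lemma walk_path a p w :
  walk (dst a) p w -> path (fun x y => dst x == src y) a p.
Proof.
elim: p a => //= b p IHp a /andP[/eqP -> /IHp ->].
by rewrite eqxx.
Qed.

(** Around a closed walk the sources are a permutation of the destinations, hence also distinct. A
    repeated link would then need both of its arcs, which [T] cannot contain. *)
Lemma closed_walk_cycle T u p :
    (forall a, a \in T -> arc_rev a \notin T) ->
    walk u p u -> p != [::] -> all (fun a => a \in T) p ->
    uniq (map (@dst G) p) ->
  is_cycle [set arc_link a | a in T] p.
Proof.
move=> revT wp p0 /allP pT Up.
have Us : uniq (map (@src G) p).
  rewrite (perm_uniq (_ : perm_eq _ (map (@dst G) p))) //.
  by rewrite -(perm_cons u) -(walk_nodes wp) perm_sym perm_rcons.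
apply/and5P; split=> //.
- by apply/allP=> a /pT aT; apply: imset_f.
- case: p wp {p0 pT Up Us} => //= a p /andP[/eqP sa wp].
  elim/last_ind: p wp => [|p b _] wp; first by rewrite /= (eqP wp) sa eqxx.
  by rewrite rcons_path (walk_path wp) last_rcons (walk_last wp) sa /=.
- rewrite map_inj_in_uniq ?(map_uniq Us) // => a b /pT aT /pT bT.
  by case/same_link=> // eb; move: (revT a aT); rewrite -eb bT.
Qed.

Lemma arborescence_path t T v : arborescence t T -> exists p, directed_path T v p t.
Proof.
case=> _ _ pathT; have [->|/pathT[p [pP _]]] := eqVneq v t; last by exists p.
by exists [::]; rewrite /directed_path /= eqxx.
Qed.

(** This turns uniqueness of paths into uniqueness of the outgoing arc. Prepend [a] to the path from
    [dst a]: if the result returns to [v], cutting it there gives a cycle; otherwise it is a second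
    path from [v]. *)
Lemma arborescence_head t T v a b p :
    arborescence t T -> v != t -> a \in T -> src a = v ->
  directed_path T v (b :: p) t -> a = b.
Proof.
move=> arbT vt aT sa bp; have [q qP] := arborescence_path (dst a) arbT.
have [revT [_ acyclic] pathT] := arbT.
have [r [_ runiq]] := pathT v vt.
have [wq qT Uq] := and3P qP.
have wa : walk v (a :: q) t by rewrite /= sa eqxx.
have aqT : all (fun a => a \in T) (a :: q) by rewrite /= aT.
have [/mapP[c cq vc]|vq] := boolP (v \in map (@dst G) (a :: q)).
  have [q1 [q2 eq_aq]] : exists q1 q2, a :: q = rcons q1 c ++ q2.
    by case/splitPr: cq => q1 q2; exists q1, q2; rewrite cat_rcons.
  move: wa aqT Uq; rewrite -/(map _ (a :: q)) eq_aq map_cat cat_uniq all_cat.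
  case/walk_cat=> w wc _ /andP[cT _] /andP[Uc _].
  have {}wc : walk v (rcons q1 c) v by rewrite {2}vc (walk_last wc).
  have := closed_walk_cycle revT wc _ cT Uc.
  by rewrite -size_eq0 size_rcons (negPf (acyclic _)) => /(_ isT).
have aq : directed_path T v (a :: q) t.
  by rewrite /directed_path wa aqT cons_uniq vq.
by have := runiq _ bp; rewrite (runiq _ aq) => -[].
Qed.

Lemma directed_path_behead T v a p w :
  directed_path T v (a :: p) w -> directed_path T (dst a) p w.
Proof.
case/and3P=> /= /andP[_ wp] /andP[_ pT] /andP[_ Up].
by rewrite /directed_path wp pT.
Qed.

End Arborescences.

(** * Counting hits on failing links *)

Section Hits.
Variables (G : multigraph) (F : {set link G}).
Variables (TT : {set {set arc_of G}}) (ord : seq {set arc_of G}).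
Implicit Types (a b : arc_of G) (v : node G) (T S : {set arc_of G}).
Implicit Types (h : seq (arc_of G)) (D : {set link G}).

(** Only the latest hit counts, since the link of an older one may be hit again. *)
Definition avoids D h :=
  if h is x :: _ then arc_link x \notin D else true.

Lemma avoids_sub D1 D2 h : D1 \subset D2 -> avoids D2 h -> avoids D1 h.
Proof. by case: h => //= x h /subsetP sub; apply: contra => /sub. Qed.

(* h is a possible record of hits, the latest one first, of a packet whose
   current arborescence is T. *)
Fixpoint hit_history T h : Prop :=
  if h is x :: h' then
    exists S, [/\ S \in TT, T = next ord S, x \in S & arc_link x \in F]
      /\ avoids [set arc_link x] h' /\ hit_history S h'
  else True.

Hypotheses (TI : trivIset TT) (circ : circular_ordering TT ord).
Hypotheses (leF : #|F| <= #|TT|.-1) (leTT : #|TT| <= 3).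

Lemma next_mem_TT T : T \in TT -> next ord T \in TT.
Proof. by have [_ ordTT] := circ; rewrite -!ordTT mem_next. Qed.

Lemma size_circular_ordering : size ord = #|TT|.
Proof. by have [Uo ordTT] := circ; rewrite -(card_uniqP Uo); apply: eq_card. Qed.

Lemma arborescence_of_arc T S a :
  T \in TT -> S \in TT -> a \in T -> a \in S -> T = S.
Proof.
move=> TTT STT aT aS; apply/eqP/negPn/negP=> neTS.
by move/trivIsetP: TI => /(_ T S TTT STT neTS)/pred0P/(_ a)/=; rewrite aT aS.
Qed.

(** A failing link forces at least two arborescences; on a single one [next] would be the
    identity. *)
Lemma next_neq e T : e \in F -> T \in TT -> next ord T != T.
Proof.
move=> eF; have [Uo ordTT] := circ; rewrite -ordTT => /rot_to[i s def_s].
have F_gt0 : 0 < #|F| by apply/card_gt0P; exists e.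
have : size (T :: s) = #|TT| by rewrite -def_s size_rot size_circular_ordering.
have : uniq (T :: s) by rewrite -def_s rot_uniq.
rewrite -(next_rot i Uo) def_s; case: s {def_s} => [_|S s] /=.
  by move=> eq1; move: leF; rewrite -eq1 leqNgt F_gt0.
by rewrite eqxx inE negb_or eq_sym => /andP[/andP[]].
Qed.

(** Starting from the arborescence of the oldest of five hits, the first, third and fifth lie in
    [T], [iter 2 (next ord) T] and [next ord T]. *)
Lemma iter4_next T :
    #|TT| = 3 -> T \in TT ->
  iter 4 (next ord) T = next ord T /\ uniq [:: T; next ord T; iter 2 (next ord) T].
Proof.
have [Uo ordTT] := circ; rewrite -ordTT => TT3 /rot_to[i s def_s].
have : size (T :: s) = 3 by rewrite -def_s size_rot size_circular_ordering.
have : uniq (T :: s) by rewrite -def_s rot_uniq.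
rewrite /= -!(next_rot i Uo) def_s; case: s {def_s} => [|A [|B []]] // Us _.
have := Us; rewrite /= !inE !negb_or => /and3P[/andP[/negPf TA /negPf TB] /negPf AB _].
by rewrite /= !eqxx ![_ == T]eq_sym TA ?eqxx ?TB ?[B == A]eq_sym ?AB ?eqxx ?TA ?TB ?AB.
Qed.

Lemma size_hit_history T h : hit_history T h -> size h < 5.
Proof.
case: h => [|x1 [|x2 [|x3 [|x4 [|x5 h]]]]] //= [S1 [[S1T _ xS1 xF1]]] [].
rewrite inE => n12 [S2 [[S2T eS1 _ xF2] []]]; rewrite inE => n23.
move=> [S3 [[S3T eS2 xS3 xF3] []]]; rewrite inE => n34.
move=> [S4 [[S4T eS3 _ xF4] []]]; rewrite inE => n45.
move=> [S5 [[S5T eS4 xS5 xF5] _]].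
have F2 : #|F| <= 2 by apply: leq_trans leF _; rewrite -subn1 leq_subLR.
have alternate (a b c : link G) :
    a \in F -> b \in F -> c \in F -> b != a -> c != b -> c = a.
  move=> aF bF cF ba cb; apply/eqP/negPn/negP=> ca.
  have : #|[set a; b; c]| <= #|F|.
    by apply/subset_leq_card/subsetP=> z; rewrite !inE -orbA => /or3P[] /eqP->.
  rewrite leqNgt => /negP; apply; apply: leq_ltn_trans F2 _.
  by rewrite setUC cardsU1 !inE negb_or ca cb cards2 eq_sym ba.
have e13 := alternate _ _ _ xF1 xF2 xF3 n12 n23.
have e35 := alternate _ _ _ xF3 xF4 xF5 n34 n45.
have TT3 : #|TT| = 3.
  apply/eqP; rewrite eqn_leq leTT /= -[3]/(2.+1) -[#|TT|]prednK ?ltnS; last first.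
    by apply/card_gt0P; exists S1.
  (* [x1] and [x2] are on distinct links of [F]. The 2 is put in the form that [cards2] gives, with
     [n12] read backwards. *)
  apply: leq_trans leF; rewrite -[2]/((true : nat).+1) -n12 -cards2.
  by apply/subset_leq_card/subsetP=> z; rewrite !inE => /orP[] /eqP->.
have [S51] := iter4_next TT3 S5T.
rewrite /= -eS4 -eS3 -eS2 -eS1 in S51 *.
rewrite -S51 /= !inE !negb_or => /and3P[/andP[/eqP n51 /eqP n53] /eqP n13 _].
have [e3|e3] := same_link e35.
  by case: n53; apply: arborescence_of_arc S5T S3T xS5 _; rewrite -e3.
have [e1|e1] := same_link e13.
  by case: n13; apply: arborescence_of_arc S1T S3T xS1 _; rewrite e1.
(* Two reversals make [x1] equal to [x5]. *)
case: n51; apply: arborescence_of_arc S5T S1T xS5 _.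
by move: xS1; rewrite e1 e3 /arc_rev /= negbK -surjective_pairing.
Qed.

(** * Following a packet to its destination *)

Variables (t : node G) (f : forwarding G) (up : nat -> {set link G}) (s : node G).
Hypothesis arbTT : forall T, T \in TT -> arborescence t T.
Hypothesis routing : circular_arborescence_routing t TT ord f.
Hypothesis upF : forall n, ~: F \subset up n.

(** One forwarding decision may skip several arborescences. Here [T] is the one reached so far, not
    necessarily that of the in-port [q], so each skip can be counted as a hit of its own. *)
Definition follows (U : {set link G}) T v (q : option (arc_of G)) :=
  forall b, first_available ord v (U :&: incident v) T b ->
    f v q (U :&: incident v) = Some b.

Lemma follows_next (U : {set link G}) T v q a :
    (forall b, b \in T -> src b = v -> b = a) -> arc_link a \notin U ->
  follows U T v q -> follows U (next ord T) v q.
Proof.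
move=> Ta aU fT b [j [bT sb bU before]]; apply: fT; exists j.+1.
rewrite iterSr; split=> // -[|i] c; last by rewrite iterSr ltnS; apply: before.
by move=> _ /Ta ca /ca ->; rewrite inE (negPf aU).
Qed.

(** Outer induction on the number [m] of further hits to allow for, inner one on the path [p] ahead.
    A hop shortens [p]; a hit lengthens [h] and leaves the instant [n] unchanged. *)
Lemma delivered_from m h T n v q p :
    5 <= m + size h -> T \in TT -> hit_history T h ->
    directed_path T v p t -> avoids [set arc_link a | a in p] h ->
    run t f up s n = Some (v, q) ->
    (v != t -> follows (up n) T v q) ->
  delivered t f up s.
Proof.
elim: m h T n v q p => [|m IHm] h T n v q p.
  by move=> le5 _ /size_hit_history; rewrite ltnNge le5.
elim: p n v q => [|a p IHp] n v q le5 TTT hist pathp avp runv fol.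
  by exists n, q; rewrite runv; case/and3P: pathp => /eqP ->.
have [vt|vt] := eqVneq v t; first by exists n, q; rewrite runv vt.
have [/= /andP[/eqP sa _] /andP[aT _] /andP[va _]] := and3P pathp.
have [aup|aup] := boolP (arc_link a \in up n).
  have fva : f v q (up n :&: incident v) = Some a.
    apply: fol => //; exists 0; split=> //.
    by rewrite inE aup -sa link_at_src.
  apply: (IHp n.+1 (dst a) (Some a)) => //.
  - exact: directed_path_behead pathp.
  - apply: avoids_sub avp; apply/subsetP=> _ /imsetP[b bp ->].
    by apply: imset_f; rewrite inE bp orbT.
  - by rewrite /= runv /= (negPf vt) fva sa eqxx aup.
  (* After the hop the in-port [a] itself identifies [T] as the current arborescence. *)
  - move=> dt b favb; have [_ /(_ T a b)] := routing dt (subsetIr (up n.+1) _).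
    exact.
have aF : arc_link a \in F.
  by apply: contraR aup => aF; apply: (subsetP (upF n)); rewrite inE.
have nextTT := next_mem_TT TTT.
have [p' pathp'] := arborescence_path v (arbTT nextTT).
apply: (IHm (a :: h) (next ord T) n v q p') => //.
- by rewrite /= addnS.
- rewrite /=; exists T; split=> //; split=> //.
  by apply: avoids_sub avp; rewrite sub1set; apply: imset_f; rewrite inE eqxx.
- apply/imsetP=> -[z zp' /esym/same_link].
  have [wp' /allP p'T /= /andP[vp' _]] := and3P pathp'.
  case=> [za|za].
    have /eqP[] := next_neq aF TTT.
    by apply: arborescence_of_arc nextTT TTT _ aT; rewrite za p'T.
  by case/mapP: vp'; exists z; rewrite // -sa za src_rev.
- move=> _; apply: follows_next aup (fol vt) => b bT sb.
  exact: arborescence_head (arbTT TTT) vt bT sb pathp.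
Qed.
End Hits.

Theorem theorem2 (k : nat) (G : multigraph) (t : node G)
    (TT : {set {set arc_of G}}) (ord : seq {set arc_of G}) (f : forwarding G) :
  1 <= k <= 3 ->
  edge_connected G k ->
  #|TT| = k ->
  (forall T : {set arc_of G}, T \in TT -> arborescence t T) ->
  trivIset TT ->
  circular_ordering TT ord ->
  circular_arborescence_routing t TT ord f ->
  dynamically_resilient k.-1 t f.
Proof.
case/andP=> _ le3 _ cardTT arbTT TI circ routing F; rewrite -cardTT => leF up upF s _.
have [->|st] := eqVneq s t; first by exists 0, None.
(* The initial arborescence is chosen from the links up at instant 0, that of the first hop. *)
have [[T TTT folT] _] := routing _ _ st (subsetIr (up 0) (incident s)).
have [p pathp] := arborescence_path s (arbTT T TTT).
(* No record of hits reaches length 5. *)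
by apply: (delivered_from (m := 5) (h := [::]) (n := 0) TI circ leF _ arbTT
  routing upF _ TTT _ pathp); rewrite ?cardTT.
Qed.
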